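(* Let $\mathcal{A}\subset\mathcal{E}$ be the union of the set $\mathcal{D}$ of Dyck paths with the set $\mathcal{D}'$ of paths in $\mathcal{E}$ having exactly one catastrophe $C_k$, $k\ge 2$, located at the end of the path. The ordinary generating function $A(x)=\sum_{P\in\mathcal{A}}x^{|P|}$ of $\mathcal{A}$ with respect to the length is $$A(x)=\frac{\left(1-\sqrt{1-4x^2}\right)(1-x)}{x\left(2x-1+\sqrt{1-4x^2}\right)},$$ and its series expansion is $$1+x^2+x^3+3x^4+4x^5+10x^6+15x^7+35x^8+56x^9+126x^{10}+210x^{11}+O(x^{12}).$$
   Context: A Dyck path with catastrophes is a finite lattice path in the first quadrant ($y\ge 0$) starting at the origin, ending on the $x$-axis, with steps $U=(1,1)$, $D=(1,-1)$ and catastrophe steps $C_k=(1,-k)$, $k\ge 2$, where a catastrophe step must end on the $x$-axis (so $C_k$ can only be used from height $k$). $\mathcal{E}$ is the set of all Dyck paths with catastrophes (including the empty path), and $\mathcal{D}\subset\mathcal{E}$ is the set of Dyck paths, i.e. paths without catastrophe steps. The length $|P|$ is the number of steps of $P$. Generating functions are formal power series in $x$, and $\sqrt{1-4x^2}$ is the power series square root with constant term $1$. *)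

(* Defs.v *)
From HB Require Import structures.
From mathcomp Require Import all_boot all_order all_algebra fraction.
From mathcomp Require Import finmap.
From mathcomp Require Import mathcomp_extra boolp classical_sets functions.
From mathcomp Require Import cardinality.

Set Implicit Arguments.
Unset Strict Implicit.
Unset Printing Implicit Defensive.

Import Order.TTheory GRing.Theory Num.Theory.

Local Open Scope classical_set_scope.
Local Open Scope ring_scope.

Record fps (R : Type) := Fps { fps_coef :> nat -> R }.

HB.instance Definition _ (R : choiceType) := [isNew for @fps_coef R].
HB.instance Definition _ (R : choiceType) := [Choice of fps R by <:].

Lemma fpsP (R : Type) (f g : fps R) : (forall n, f n = g n) <-> f = g.
Proof.
split=> [|-> //]; case: f g => [f] [g] /= fg.
by congr Fps; apply/funext.
Qed.

Section FpsRing.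
Variable R : idomainType.
Implicit Types f g h : fps R.

Definition fps_zero : fps R := Fps (fun=> 0).
Definition fps_one : fps R := Fps (fun n => (n == 0%N)%:R).
Definition fps_opp f : fps R := Fps (fun n => - f n).
Definition fps_add f g : fps R := Fps (fun n => f n + g n).
Definition fps_mul f g : fps R :=
  Fps (fun n => \sum_(i < n.+1) f i * g (n - i)%N).

Fact fps_addA : associative fps_add.
Proof. by move=> f g h; apply/fpsP => n /=; rewrite addrA. Qed.
Fact fps_addC : commutative fps_add.
Proof. by move=> f g; apply/fpsP => n /=; rewrite addrC. Qed.
Fact fps_add0 : left_id fps_zero fps_add.
Proof. by move=> f; apply/fpsP => n /=; rewrite add0r. Qed.
Fact fps_addN : left_inverse fps_zero fps_opp fps_add.
Proof. by move=> f; apply/fpsP => n /=; rewrite addNr. Qed.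

HB.instance Definition _ :=
  GRing.isZmodule.Build (fps R) fps_addA fps_addC fps_add0 fps_addN.

(* The truncation of f at degree n, through which the ring laws are inherited
   from {poly R}. *)
Definition fps_trunc n f : {poly R} := \poly_(i < n.+1) f i.

Lemma coef_fps_trunc n f k : (k <= n)%N -> (fps_trunc n f)`_k = f k.
Proof. by move=> kn; rewrite coef_poly ltnS kn. Qed.

Lemma coef_fps_mul n f g k : (k <= n)%N ->
  fps_mul f g k = (fps_trunc n f * fps_trunc n g)`_k.
Proof.
move=> kn; rewrite coefM /=; apply: eq_bigr => i _.
have ik : (i <= k)%N by rewrite -ltnS.
by rewrite !coef_fps_trunc ?(leq_trans ik)// (leq_trans (leq_subr _ _)).
Qed.

Fact fps_mulC : commutative fps_mul.
Proof.
by move=> f g; apply/fpsP => n; rewrite !(@coef_fps_mul n)// mulrC.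
Qed.

Fact fps_mulA : associative fps_mul.
Proof.
move=> f g h; apply/fpsP => n; rewrite !(@coef_fps_mul n)//.
have -> : (fps_trunc n (fps_mul f g) * fps_trunc n h)`_n =
          ((fps_trunc n f * fps_trunc n g) * fps_trunc n h)`_n.
  rewrite !coefM; apply: eq_bigr => i _; congr (_ * _).
  by rewrite coef_fps_trunc -1?ltnS// (@coef_fps_mul n) -1?ltnS.
rewrite -mulrA !coefM; apply: eq_bigr => i _; congr (_ * _).
by rewrite coef_fps_trunc ?leq_subr// (@coef_fps_mul n) ?leq_subr.
Qed.

Fact fps_mul1 : left_id fps_one fps_mul.
Proof.
move=> f; apply/fpsP => n /=.
rewrite big_ord_recl /= mul1r subn0 big1 ?addr0// => i _.
by rewrite mul0r.
Qed.

Fact fps_mulDl : left_distributive fps_mul +%R.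
Proof.
move=> f g h; apply/fpsP => n /=; rewrite -big_split /=.
by apply: eq_bigr => i _; rewrite mulrDl.
Qed.

Fact fps_one_neq0 : fps_one != 0.
Proof.
by apply/eqP => /fpsP/(_ 0%N)/= /eqP; rewrite oner_eq0.
Qed.

HB.instance Definition _ := GRing.Zmodule_isComNzRing.Build (fps R)
  fps_mulA fps_mulC fps_mul1 fps_mulDl fps_one_neq0.

Definition fps_unit : {pred fps R} := fun f => `[< exists g, g * f = 1 >].
Definition fps_inv f : fps R := xget f [set g | g * f = 1].

Fact fps_mulVx : {in fps_unit, left_inverse 1 fps_inv *%R}.
Proof. by move=> f /asboolP; apply: (xgetPex f). Qed.
Fact fps_unitPl f g : g * f = 1 -> fps_unit f.
Proof. by move=> gf; apply/asboolP; exists g. Qed.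
Fact fps_inv_out : {in [predC fps_unit], fps_inv =1 id}.
Proof.
move=> f /asboolP fN; rewrite /fps_inv; case: xgetP => // g _ /= gf.
by case: fN; exists g.
Qed.

HB.instance Definition _ := GRing.ComNzRing_hasMulInverse.Build (fps R)
  fps_mulVx fps_unitPl fps_inv_out.

Lemma fps_coef0 n : (0 : fps R) n = 0. Proof. by []. Qed.
Lemma fps_coef1 n : (1 : fps R) n = (n == 0%N)%:R. Proof. by []. Qed.
Lemma fps_coefD f g n : (f + g) n = f n + g n. Proof. by []. Qed.
Lemma fps_coefN f n : (- f) n = - f n. Proof. by []. Qed.
Lemma fps_coefM f g n : (f * g) n = \sum_(i < n.+1) f i * g (n - i)%N.
Proof. by []. Qed.

Lemma fps_order f : f != 0 -> exists2 m, f m != 0 & forall i, (i < m)%N -> f i = 0.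
Proof.
move=> fn0; have [m fm] : exists m, f m != 0.
  apply/not_existsP => f0; case/eqP: fn0; apply/fpsP => n.
  by apply/eqP/negPn/negP/f0.
case: (ex_minnP (ex_intro (fun m => f m != 0) m fm)) => k fk kmin.
exists k => // i ik; apply/eqP/negPn/negP => /kmin.
by rewrite leqNgt ik.
Qed.

Fact fps_integral : GRing.integral_domain_axiom (fps R).
Proof.
move=> f g fg0; apply/negPn/negP; rewrite negb_or => /andP[].
move=> /fps_order[m fm fltm] /fps_order[k gk gltk].
move/fpsP/(_ (m + k)%N): fg0; rewrite fps_coefM.
have mlt : (m < (m + k).+1)%N by rewrite ltnS leq_addr.
rewrite (bigD1 (Ordinal mlt))//= addKn big1 => [|i /eqP im].
  by rewrite addr0 => /eqP; rewrite mulf_eq0 (negPf fm) (negPf gk).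
have [/fltm-> |mi] := ltnP i m; first by rewrite mul0r.
rewrite (gltk (m + k - i)%N) ?mulr0//.
have {}mi : (m < i)%N.
  by rewrite ltn_neqAle mi andbT; apply/eqP => mi'; apply: im; apply/val_inj.
rewrite ltn_subLR; first by rewrite ltn_add2r.
by rewrite -ltnS.
Qed.

HB.instance Definition _ := GRing.ComUnitRing_isIntegral.Build (fps R)
  fps_integral.

Definition fpsX : fps R := Fps (fun n => (n == 1%N)%:R).

(* The square root of f with constant term 1; it is 0 when there is none.
   See [fps_sqrtP] and [fps_sqrt_uniq]. *)
Definition fps_sqrt f : fps R := xget 0 [set s | s ^+ 2 = f /\ s 0%N = 1].

End FpsRing.

Section FpsSqrt.
Variables (K : fieldType) (f : fps K).
Hypotheses (K2 : 2 != 0 :> K) (f0 : f 0%N = 1).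

Fixpoint fps_sqrt_seq n : seq K :=
  if n is m.+1 then
    let s := fps_sqrt_seq m in
    rcons s ((f m.+1 - \sum_(i < m) s`_i.+1 * s`_(m - i)) / 2)
  else [:: 1].

Let r n := (fps_sqrt_seq n)`_n.

Let size_sqrt_seq n : size (fps_sqrt_seq n) = n.+1.
Proof. by elim: n => //= n IHn; rewrite size_rcons IHn. Qed.

Let nth_sqrt_seq n i : (i <= n)%N -> (fps_sqrt_seq n)`_i = r i.
Proof.
elim: n => [|n IHn]; first by rewrite leqn0 => /eqP->.
rewrite leq_eqVlt => /predU1P[-> //|]; rewrite ltnS => ilen.
by rewrite /= nth_rcons size_sqrt_seq ltnS ilen IHn.
Qed.

Lemma fps_sqrt_exists : exists s : fps K, s ^+ 2 = f /\ s 0%N = 1.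
Proof.
exists (Fps r); split=> //; apply/fpsP => -[|n].
  by rewrite expr2 fps_coefM big_ord1 /= mul1r f0.
rewrite expr2 fps_coefM big_ord_recl big_ord_recr /= subnn subn0.
have -> : r n.+1 = (f n.+1 - \sum_(i < n) r i.+1 * r (n - i)%N) / 2.
  rewrite {1}/r /= nth_rcons size_sqrt_seq ltnn eqxx.
  congr ((_ - _) / _); apply: eq_bigr => i _.
  by rewrite !nth_sqrt_seq ?leq_subr.
rewrite {1 5}/r /= mul1r mulr1 addrCA addrC.
rewrite [X in _ + X](_ : _ = \sum_(i < n) r i.+1 * r (n - i)%N)//.
by rewrite -mulrDl -mulr2n -[X in X / 2]mulr_natr mulfK// subrK.
Qed.

Lemma fps_sqrtP : fps_sqrt f ^+ 2 = f /\ fps_sqrt f 0%N = 1.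
Proof. exact: (xgetPex 0 fps_sqrt_exists). Qed.

Lemma fps_sqrt_uniq (s : fps K) : s ^+ 2 = f -> s 0%N = 1 -> s = fps_sqrt f.
Proof.
move=> s2 s0; have [t2 t0] := fps_sqrtP.
have /eqP : s ^+ 2 = fps_sqrt f ^+ 2 by rewrite s2 t2.
rewrite eqf_sqr => /orP[/eqP //|/eqP st].
have /eqP := s0; rewrite st fps_coefN t0 eq_sym -subr_eq0 opprK.
by rewrite -[1 + 1]/(2%:R) (negPf K2).
Qed.

End FpsSqrt.

(* C k is the step (1, -k). The constraint 2 <= k is part of [catastrophe_path]
   below. *)
Inductive step := U | D | C of nat.

Definition step_code (s : step) : option (option nat) :=
  match s with U => None | D => Some None | C k => Some (Some k) end.
Definition step_decode (c : option (option nat)) : step :=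
  match c with None => U | Some None => D | Some (Some k) => C k end.
Lemma step_codeK : cancel step_code step_decode. Proof. by case. Qed.

HB.instance Definition _ := Countable.copy step (can_type step_codeK).

Definition rise (s : step) : int :=
  match s with U => 1 | D => -1 | C k => - k%:Z end.

Definition is_catastrophe (s : step) : bool := if s is C _ then true else false.

(* A lattice path starting at the origin is the sequence of its steps; its
   length is the size of the sequence, and its i-th point is
   (i, height (take i p)). *)
Definition height (p : seq step) : int := \sum_(s <- p) rise s.

Definition catastrophe_path : set (seq step) := [set p |
  [/\ (forall i, (i <= size p)%N -> 0 <= height (take i p)),
      height p = 0
    & forall q k r, p = q ++ C k :: r ->
        (2 <= k)%N /\ height (rcons q (C k)) = 0]].

Definition dyck_path : set (seq step) :=
  [set p | catastrophe_path p /\ ~~ has is_catastrophe p].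

Definition final_catastrophe_path : set (seq step) :=
  [set p | [/\ catastrophe_path p, count is_catastrophe p = 1%N
             & is_catastrophe (last U p)]].

Definition dyck_final_catastrophe_path : set (seq step) :=
  dyck_path `|` final_catastrophe_path.

(* [fset_set] is the finite set underlying a finite set, and is empty on
   infinite ones; the sets used here are finite by [catastrophe_path_finite]. *)
Definition ogf (S : set (seq step)) : fps rat :=
  Fps (fun n => #|` fset_set [set p | S p /\ size p = n]|%:R).

Lemma height_size p : height p <= (size p)%:Z.
Proof.
rewrite /height; elim: p => [|s p IHp]; first by rewrite big_nil.
rewrite big_cons /= -addn1 PoszD addrC; apply: lerD => //.
by case: s => //= k; rewrite (@le_trans _ _ 0)// oppr_le0.
Qed.

Lemma catastrophe_path_step p s : catastrophe_path p -> s \in p ->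
  s \in U :: D :: [seq C k | k <- iota 0 (size p).+1].
Proof.
case: s => [||k] [_ _ cP] kp; [by []|by []|].
suff kn : (k <= size p)%N.
  by rewrite 2!in_cons map_f ?orbT// mem_iota.
case/path.splitPr: kp cP => q r cP; have [_] := cP q k r erefl.
rewrite /height -cats1 big_cat big_seq1 /= => /eqP.
rewrite subr_eq0 => /eqP hk; rewrite -lez_nat -hk.
rewrite (le_trans (height_size q))// lez_nat size_cat.
exact: leq_addr.
Qed.

Lemma catastrophe_path_finite (S : set (seq step)) n :
  S `<=` catastrophe_path -> finite_set [set p | S p /\ size p = n].
Proof.
move=> SE; pose A := U :: D :: [seq C k | k <- iota 0 n.+1].
pose T := seq_sub A.
apply: (@sub_finite_set _ _ [set` [seq map val (t : seq T) | t : n.-tuple T]]).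
  move=> p [/SE Ep pn].
  have pA : all [in A] p.
    by apply/allP => s; rewrite /A -pn; apply: catastrophe_path_step.
  pose t := pmap (insub : step -> option T) p.
  have tp : map val t = p.
    by rewrite (pmap_filter (insubK _)); apply/all_filterP; rewrite (eq_all (isSome_insub _)).
  have st : size t == n by rewrite -pn -tp size_map.
  by apply/mapP; exists (Tuple st); rewrite ?mem_enum.
exact: finite_seq.
Qed.

Lemma dyck_final_catastrophe_path_sub :
  dyck_final_catastrophe_path `<=` catastrophe_path.
Proof. by move=> p [[]|[]]. Qed.

(* Main.v *)
Require Import Defs.
From mathcomp Require Import all_boot all_order all_algebra fraction.
From mathcomp Require Import finmap classical_sets cardinality.
From mathcomp Require Import zify ring.

(** Removing the final catastrophe from a path of length [n + 1] leaves a
    nonnegative [U]/[D]-path of length [n] ending at height at least 2, and every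
    such path arises once; moreover the Dyck paths of length [n + 1] correspond
    to those ending at height 1.  Hence [a (n + 1)] counts the nonnegative
    paths of length [n] that do not end on the axis: with [W] and [c] the series
    of all nonnegative paths and of Dyck paths, [A = 1 + x (W - c)].  Removing
    the last step gives [(1 - 2x) W = 1 - x c], and for the series [H k] of the
    paths ending at height [k], a linear recurrence in [k] whose unique solution
    is [H k = x^k c^(k+1)], where [c = 1 + x^2 c^2], that is
    [sqrt (1 - 4x^2) = 1 - 2 x^2 c]. *)

Set Implicit Arguments.
Unset Strict Implicit.
Unset Printing Implicit Defensive.

Import Order.TTheory GRing.Theory Num.Theory.
Local Open Scope classical_set_scope.
Local Open Scope ring_scope.

(** * Coefficients and expansions of power series *)

Section FormalPowerSeries.
Context {R : idomainType}.
Implicit Types f g : fps R.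
Local Notation x := (fpsX R).

Lemma fps_coefXM f n : (x * f) n = if n is m.+1 then f m else 0.
Proof.
rewrite fps_coefM; case: n => [|n]; first by rewrite big_ord1 mul0r.
rewrite big_ord_recl mul0r add0r big_ord_recl /= mul1r subn1 /= big1 ?addr0//.
by move=> i _; rewrite mul0r.
Qed.

Lemma fps_coef_natl m f n : (m%:R * f) n = m%:R * f n.
Proof.
rewrite !mulr_natl; elim: m => [|m IHm]; first by rewrite !mulr0n.
by rewrite !mulrS fps_coefD IHm.
Qed.

Lemma fpsX_neq0 : x != 0.
Proof. by apply/eqP => /fpsP/(_ 1%N)/= /eqP; rewrite oner_eq0. Qed.

Definition fps_shift m f : fps R := Fps (fun n => f (n + m)%N).

(** Natural coefficients allow each constant series to be the numeral [(a i)%:R], so that [ring] can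
    handle the expansion. The induction peels one constant term off the shifted series. *)
Lemma fps_expansion f (a : nat -> nat) m : (forall n, f n = (a n)%:R) ->
  f = \sum_(i < m) (a i)%:R * x ^+ i + x ^+ m * fps_shift m f.
Proof.
move=> fa; elim: m => [|m IHm].
  by rewrite big_ord0 add0r mul1r; apply/fpsP => n /=; rewrite addn0.
rewrite {1}IHm big_ord_recr /= -addrA; congr (_ + _).
have -> : fps_shift m f = (a m)%:R + x * fps_shift m.+1 f.
  apply/fpsP => -[|n]; rewrite fps_coefD fps_coefXM -[(a m)%:R]mulr1.
    by rewrite fps_coef_natl fps_coef1 mulr1 addr0 -fa.
  by rewrite fps_coef_natl fps_coef1 mulr0 add0r /= addSnnS.
by rewrite exprSr; ring.
Qed.

End FormalPowerSeries.

(** * Nonnegative paths, built by their last step *)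

Lemma height_rcons p s : height (rcons p s) = height p + rise s.
Proof. by rewrite /height -cats1 big_cat big_seq1. Qed.

(** The index is unbounded because [take] beyond the end returns the whole path; appending a step
    then involves no change of range. *)
Definition nonneg_path (p : seq step) : Prop :=
  forall i, 0 <= height (take i p).

Lemma nonneg_path_height p : nonneg_path p -> 0 <= height p.
Proof. by move=> /(_ (size p)); rewrite take_size. Qed.

Lemma nonneg_path_rcons p s :
  nonneg_path (rcons p s) <-> nonneg_path p /\ 0 <= height (rcons p s).
Proof.
split=> [ps|[pp hs] i].
  split=> [i|]; last exact: nonneg_path_height.
  have [ip|/ltnW pi] := leqP i (size p).
    by move: (ps i); rewrite -cats1 takel_cat.
  by move: (ps (size p)); rewrite -cats1 takel_cat// take_size take_oversize.
have [ip|pi] := leqP i (size p); first by rewrite -cats1 takel_cat.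
by rewrite take_oversize// size_rcons.
Qed.

Lemma nonneg_pathE p :
  (forall i, (i <= size p)%N -> 0 <= height (take i p)) <-> nonneg_path p.
Proof.
split=> pp i //; have [/pp//|/ltnW pi] := leqP i (size p).
by rewrite take_oversize// -[X in height X]take_size pp.
Qed.

Definition prefix_at n k p :=
  [/\ size p = n, ~~ has is_catastrophe p, nonneg_path p & height p = k%:Z].

Fixpoint prefixes n k : seq (seq step) :=
  if n is m.+1 then
    (if k is j.+1 then [seq rcons p U | p <- prefixes m j] else [::])
    ++ [seq rcons p D | p <- prefixes m k.+1]
  else if k is 0 then [:: [::]] else [::].

Lemma prefixesP n k p : reflect (prefix_at n k p) (p \in prefixes n k).
Proof.
apply: (iffP idP); last first.
  elim/last_ind: p n k => [|p s IHp] n k [<- /=].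
    move=> _ _; rewrite /height big_nil => -[<-].
    by rewrite inE.
  rewrite has_rcons negb_or => /andP[sC pC] /nonneg_path_rcons[pp _].
  rewrite height_rcons => hk; rewrite size_rcons /= mem_cat.
  have h0 := nonneg_path_height pp.
  case: s sC hk => //= _ hk.
    case: k hk => [|k] hk; first by lia.
    by rewrite (map_f (rcons^~ U))//; apply: IHp; split=> //; lia.
  by rewrite orbC (map_f (rcons^~ D))//; apply: IHp; split=> //; lia.
elim: n k p => [|n IHn] k p /=.
  case: k => // /[!inE] /eqP->; split=> //; last by rewrite /height big_nil.
  by move=> i; rewrite /height big_nil.
rewrite mem_cat => /orP[].
  case: k => // k /mapP[q /IHn[<- qC qq hq] ->].
  split; rewrite ?size_rcons ?has_rcons//; last by rewrite height_rcons hq /=; lia.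
  by apply/nonneg_path_rcons; split=> //; rewrite height_rcons hq.
move=> /mapP[q /IHn[<- qC qq hq] ->].
have hk : height (rcons q D) = k%:Z by rewrite height_rcons hq /=; lia.
split; rewrite ?size_rcons ?has_rcons//.
by apply/nonneg_path_rcons; rewrite hk.
Qed.

Lemma prefixes_uniq n k : uniq (prefixes n k).
Proof.
elim: n k => [|n IHn] [|k] //=.
  by rewrite map_inj_uniq//; apply: rcons_injl.
rewrite cat_uniq !map_inj_uniq ?IHn//=; try exact: rcons_injl.
rewrite andbT; apply/hasPn => _ /mapP[p _ ->]; apply/negP => /mapP[q _].
by move/rcons_inj => -[].
Qed.

(** * Ballot numbers and the count of nonnegative paths *)

Fixpoint ballot n k : nat :=
  if n is m.+1 then ((if k is j.+1 then ballot m j else 0) + ballot m k.+1)%N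
  else (k == 0%N).

Lemma size_prefixes n k : size (prefixes n k) = ballot n k.
Proof.
elim: n k => [|n IHn] [|k] //=; first by rewrite size_map IHn.
by rewrite size_cat !size_map !IHn.
Qed.

Lemma ballot_gt n k : (n < k)%N -> ballot n k = 0%N.
Proof. by elim: n k => [|n IHn] [|k] //= nk; rewrite !IHn//; lia. Qed.

(* [sumn] rather than [\sum], whose lock blocks computation. *)
Definition nonneg_count n := sumn [seq ballot n k | k <- iota 0 n.+1].

Lemma nonneg_countE n : nonneg_count n = (\sum_(k < n.+1) ballot n k)%N.
Proof.
by rewrite /nonneg_count sumnE big_map -[iota 0 _]/(index_iota 0 n.+1) big_mkord.
Qed.

(** A nonnegative path extends by [U] or by [D], except that [D] is forbidden at height 0; the term
    [ballot n 0] restores these missing extensions. *)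
Lemma nonneg_countS n : (nonneg_count n.+1 + ballot n 0 = 2 * nonneg_count n)%N.
Proof.
rewrite !nonneg_countE (eq_bigr (fun k : 'I_n.+2 =>
  ((if k : nat is j.+1 then ballot n j else 0) + ballot n k.+1)%N)); last by [].
rewrite big_split /= -addnA [X in (X + _)%N]big_ord_recl add0n.
rewrite mul2n -addnn; congr (_ + _)%N.
(* Two vanishing terms are added, so that splitting off height 0 leaves exactly the heights [k.+1]
   with [k < n.+2]. *)
have -> : (\sum_(k < n.+1) ballot n k = \sum_(k < n.+3) ballot n k)%N.
  rewrite [RHS]big_ord_recr /= [X in (X + _)%N]big_ord_recr /=.
  by rewrite !ballot_gt ?addn0.
by rewrite [RHS]big_ord_recl addnC.
Qed.

(** * Enumeration of the Dyck paths and of the paths with a final catastrophe *)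

Definition dyck_final_enum n : seq (seq step) :=
  prefixes n 0 ++ (if n is m.+1 then
    [seq rcons p (C k) | k <- iota 2 m.-1, p <- prefixes m k] else [::]).

Lemma dyck_pathP n p :
  dyck_path p /\ size p = n <-> prefix_at n 0 p.
Proof.
split=> [[[[pp h0 _] pC] pn]|[pn pC pp h0]].
  by split=> //; apply/nonneg_pathE.
split=> //; split=> //; split=> //.
by move=> q k r pE; move: pC; rewrite pE has_cat /= orbT.
Qed.

Lemma final_catastrophe_pathP n p :
  final_catastrophe_path p /\ size p = n.+1 <->
  exists q k, [/\ p = rcons q (C k), (2 <= k)%N & prefix_at n k q].
Proof.
split=> [[[[pp h0 pC] p1 pL] pn]|[q [k [-> k2 [qn qC qq hq]]]]].
  case/lastP: p pp h0 pC p1 pL pn => // q s pp h0 pC.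
  rewrite last_rcons size_rcons => p1; case: s pp h0 pC p1 => // k pp h0 pC.
  rewrite -cats1 count_cat /= => q0 _ [qn].
  have [k2 _] := pC q k [::] (esym (cats1 _ _)).
  have /nonneg_pathE/nonneg_path_rcons[qq _] := pp.
  exists q, k; split=> //; first by rewrite cats1.
  split=> //; first by rewrite has_count; lia.
  by move: h0; rewrite height_rcons /=; lia.
have h0 : height (rcons q (C k)) = 0 by rewrite height_rcons hq /= subrr.
split; last by rewrite size_rcons qn.
split; [split=> //| |by rewrite last_rcons].
- by apply/nonneg_pathE/nonneg_path_rcons; rewrite h0.
(* A catastrophe is either the last step, or lies in [q], which has none. *)
- move=> q' k'; case/lastP => [|r z].
    by rewrite cats1 => /rcons_inj[<- <-].
  rewrite -rcons_cons -rcons_cat => /rcons_inj[qE _].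
  by move: qC; rewrite qE has_cat /= orbT.
- by rewrite -cats1 count_cat /=; move: qC; rewrite has_count; lia.
Qed.

Lemma dyck_final_enumP n p :
  dyck_final_catastrophe_path p /\ size p = n <-> p \in dyck_final_enum n.
Proof.
rewrite /dyck_final_enum mem_cat; split.
  move=> [[pD|pF] pn].
    by apply/orP; left; apply/prefixesP/dyck_pathP.
  case: n pn => [|n] pn; first by move: pF; rewrite (size0nil pn) => -[].
  have [q [k [-> k2 qP]]] := (final_catastrophe_pathP n p).1 (conj pF pn).
  apply/orP; right; apply/allpairsPdep; exists k, q; split=> //; last by apply/prefixesP.
  (* A prefix never rises above its length, so the heights in [iota 2 n.-1], from 2 to [n], exhaust
     the final catastrophes. *)
  have [qn _ _ hq] := qP; have := height_size q.
  by rewrite mem_iota; lia.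
move=> /orP[/prefixesP/dyck_pathP[pD pn]|]; first by split=> //; left.
case: n => // n /allpairsPdep[k [q [kn /prefixesP qP pE]]].
have [|pF pn] := (final_catastrophe_pathP n p).2.
  by exists q, k; split=> //; move: kn; rewrite mem_iota => /andP[].
by split=> //; right.
Qed.

Lemma dyck_final_enum_uniq n : uniq (dyck_final_enum n).
Proof.
rewrite /dyck_final_enum; case: n => [|n]; first by [].
rewrite cat_uniq prefixes_uniq andTb; apply/andP; split.
  apply/hasPn => _ /allpairsPdep[k [q [_ _ ->]]].
  by apply/negP => /prefixesP[_]; rewrite has_rcons.
apply: allpairs_uniq_dep; first exact: iota_uniq.
  by move=> k _; apply: prefixes_uniq.
by move=> [k p] [l q] _ _ /= /rcons_inj[-> ->].
Qed.

(** The truncated subtraction is exact, since [ballot m 0] is one of the terms of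
    [nonneg_count m]. *)
Definition dyck_final_count n : nat :=
  if n is m.+1 then (nonneg_count m - ballot m 0)%N else 1%N.

Definition first_counts := [:: 1; 0; 1; 1; 3; 4; 10; 15; 35; 56; 126; 210]%N.

Lemma first_countsE : mkseq dyck_final_count 12 = first_counts.
Proof. by vm_compute. Qed.

Lemma size_dyck_final_enum n : size (dyck_final_enum n) = dyck_final_count n.
Proof.
rewrite /dyck_final_enum size_cat size_prefixes; case: n => // n.
rewrite size_allpairs_dep /= nonneg_countE big_ord_recl /= add0n addKn.
under eq_map do rewrite size_prefixes.
rewrite sumnE big_map.
case: n => [|n]; first by rewrite big_nil big_ord0.
(* Height 1 accounts for the Dyck paths, the greater heights for the catastrophes. *)
rewrite big_ord_recl; congr (_ + _)%N.
rewrite (iotaDl 2 0) big_map -[n in iota 0 n]subn0 -/(index_iota 0 n) big_mkord.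
by apply: eq_bigr.
Qed.

Lemma card_fset_set_enum (T : choiceType) (S : set T) (s : seq T) :
  uniq s -> (forall p, S p <-> p \in s) -> #|` fset_set S| = size s.
Proof.
move=> s_uniq Ss; have SE : S = [set` [fset p in s]%fset].
  by apply/seteqP; split=> p /=; rewrite in_fset /= Ss.
by rewrite SE set_fsetK card_fseq undup_id.
Qed.

Lemma ogf_dyck_final n :
  ogf dyck_final_catastrophe_path n = (dyck_final_count n)%:R.
Proof.
rewrite /= -size_dyck_final_enum; congr (_%:R).
apply: card_fset_set_enum (dyck_final_enum_uniq n) _ => p.
exact: dyck_final_enumP.
Qed.

(** * The Catalan equation and the generating functions *)

Section GeneratingFunctions.
Local Notation x := (fpsX rat).
Local Notation s := (fps_sqrt (1 - 4 * x ^+ 2)).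

Lemma fps_sqrt_catalan : exists2 c : fps rat,
  c = 1 + x ^+ 2 * c ^+ 2 & s = 1 - 2 * x ^+ 2 * c.
Proof.
have f0 : (1 - 4 * x ^+ 2 : fps rat) 0%N = 1.
  by rewrite fps_coefD fps_coefN fps_coef_natl expr2 fps_coefXM mulr0 subr0.
have := fps_sqrtP (isT : 2 != 0 :> rat) f0; set r := s => -[s2 s0].
have s1 : r 1%N = 0.
  move/fpsP/(_ 1%N): s2; rewrite fps_coefD fps_coefN fps_coef_natl !expr2.
  rewrite fps_coefXM [LHS]fps_coefM !big_ord_recl big_ord0 /= mulr0 subr0.
  by rewrite s0 mulr1 mul1r addr0 => /eqP; rewrite -mulr2n mulrn_eq0 /= => /eqP.
(* This is [(1 - s) / (2 * x ^+ 2)] read off coefficientwise; the division is exact because [s]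
   begins with 1 and 0. *)
pose c : fps rat := Fps (fun n => - r n.+2 / 2).
have sE : r = 1 - 2 * x ^+ 2 * c.
  apply/fpsP => n; rewrite fps_coefD fps_coefN -mulrA fps_coef_natl expr2 -mulrA.
  rewrite fps_coefXM; case: n => [|n]; first by rewrite s0 mulr0 subr0.
  rewrite fps_coefXM; case: n => [|n]; first by rewrite s1 mulr0 subr0.
  by rewrite fps_coef1 sub0r /= [2 * _]mulrC divfK// opprK.
exists c => //.
have c4 : (4 : fps rat) * x ^+ 2 != 0.
  rewrite mulf_neq0 ?expf_neq0 ?fpsX_neq0//; apply/eqP => /fpsP/(_ 0%N).
  by rewrite -[4]mulr1 fps_coef_natl.
(* Squaring [1 - 2 * x ^+ 2 * c] turns the equation of [s] into the Catalan equation multiplied by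
   [4 * x ^+ 2]. *)
apply: (mulfI c4); move: s2; rewrite sE => s2.
apply/eqP; rewrite -subr_eq0; apply/eqP.
transitivity (1 - 4 * x ^+ 2 - (1 - 2 * x ^+ 2 * c) ^+ 2); first by ring.
by rewrite s2 subrr.
Qed.

(** The series [x ^+ k * c ^+ k.+1] obey the last-step recurrence of [ballot]. Its factor [x]
    expresses each coefficient of degree [n.+1] by coefficients of degree [n], so induction on [n],
    for all [k] at once, identifies the two. *)
Lemma ballot_series (c : fps rat) : c = 1 + x ^+ 2 * c ^+ 2 ->
  forall n k, (x ^+ k * c ^+ k.+1) n = (ballot n k)%:R.
Proof.
move=> cE; pose H k := x ^+ k * c ^+ k.+1.
have H0 : H 0%N = 1 + x * H 1%N by rewrite /H {1}cE; ring.
have HS k : H k.+1 = x * (H k + H k.+2).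
  by rewrite /H [c ^+ k.+2]exprSr {2}cE !exprS; ring.
rewrite -/(H _); elim=> [|n IHn] k.
  case: k => [|k]; rewrite -/(H _).
    by rewrite H0 fps_coefD fps_coefXM addr0.
  by rewrite HS fps_coefXM.
case: k => [|k]; rewrite -/(H _).
  by rewrite H0 fps_coefD fps_coefXM add0r [H _ _]IHn.
by rewrite HS fps_coefXM fps_coefD [H _ _]IHn [H _ _]IHn -natrD.
Qed.

Lemma nonneg_count_series (c : fps rat) : c = 1 + x ^+ 2 * c ^+ 2 ->
  (1 - 2 * x) * Fps (fun n => (nonneg_count n)%:R) = 1 - x * c.
Proof.
move=> /ballot_series cE; have {}cE n : c n = (ballot n 0)%:R.
  by rewrite -cE mul1r.
rewrite mulrBl mul1r -mulrA; apply/fpsP => -[|n].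
  rewrite !(fps_coefD, fps_coefN, fps_coef_natl, fps_coefXM) /=.
  by rewrite mulr0 nonneg_countE big_ord1.
rewrite !(fps_coefD, fps_coefN, fps_coef_natl, fps_coefXM) /= cE.
have /(congr1 (fun m => m%:R : rat)) := nonneg_countS n.
by rewrite natrD natrM => <-; ring.
Qed.

Lemma ogf_dyck_final_series (c : fps rat) : c = 1 + x ^+ 2 * c ^+ 2 ->
  ogf dyck_final_catastrophe_path =
  1 + x * (Fps (fun n => (nonneg_count n)%:R) - c).
Proof.
move=> /ballot_series cE; apply/fpsP => n.
rewrite ogf_dyck_final fps_coefD fps_coefXM; case: n => [|n] /=.
  by rewrite addr0.
rewrite add0r natrB ?leq_sum//; first by rewrite -cE mul1r.
by rewrite nonneg_countE big_ord_recl leq_addr.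
Qed.

End GeneratingFunctions.

Theorem theorem2p2 :
  let x : fps rat := fpsX rat in
  let A : fps rat := ogf dyck_final_catastrophe_path in
  let s : fps rat := fps_sqrt (1 - 4 * x ^+ 2) in
  tofrac A = tofrac ((1 - s) * (1 - x)) / tofrac (x * (2 * x - 1 + s))
  /\
  exists B : fps rat,
    A = 1 + x ^+ 2 + x ^+ 3 + 3 * x ^+ 4 + 4 * x ^+ 5 + 10 * x ^+ 6
          + 15 * x ^+ 7 + 35 * x ^+ 8 + 56 * x ^+ 9 + 126 * x ^+ 10
          + 210 * x ^+ 11 + x ^+ 12 * B.
Proof.
move=> x A s; split; last first.
  exists (fps_shift 12 A); rewrite {1}/A (fps_expansion 12 ogf_dyck_final) -/A.
  rewrite (eq_bigr (fun i : 'I_12 => (nth 0%N first_counts i)%:R * x ^+ i)).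
    by rewrite !big_ord_recr big_ord0 /= -/x; ring.
  by move=> i _; rewrite -first_countsE nth_mkseq.
have [c cE sE] := fps_sqrt_catalan; rewrite -/x -/s in cE sE.
have := nonneg_count_series cE; have := ogf_dyck_final_series cE.
rewrite -/A -/x; set W := Fps _ => AE WE.
have xc0 : 1 - x * c != 0.
  apply/eqP => /fpsP/(_ 0%N)/eqP.
  by rewrite fps_coefD fps_coefN fps_coefXM subr0 oner_eq0.
have two0 : 2 != 0 :> fps rat.
  by apply/eqP => /fpsP/(_ 0%N); rewrite -[2]mulr1 fps_coef_natl.
have x20 : 1 - 2 * x != 0.
  apply/eqP => /fpsP/(_ 0%N)/eqP.
  by rewrite fps_coefD fps_coefN fps_coef_natl mulr0 subr0 oner_eq0.
have dE : x * (2 * x - 1 + s) = 2 * x ^+ 2 * (1 - x * c) by rewrite sE; ring.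
have d0 : x * (2 * x - 1 + s) != 0.
  by rewrite dE !mulf_neq0 ?fpsX_neq0.
apply: (canRL (mulfK _)); first by rewrite tofrac_eq0.
(* With denominators cleared, multiplying by [1 - 2 * x] allows the equation of [W] to be used
   without inverting a series. *)
rewrite -tofracM; congr tofrac; apply: (mulfI x20).
have {}AE : (1 - 2 * x) * A = (1 - x) * (1 - x * c).
  transitivity (1 - 2 * x + x * ((1 - 2 * x) * W) - x * (1 - 2 * x) * c).
    by rewrite AE; ring.
  by rewrite WE; ring.
(* This form of the Catalan equation absorbs the two factors [1 - x * c], one from [A] and one from
   the denominator. *)
have c2 : (1 - x * c) ^+ 2 = (1 - 2 * x) * c.
  transitivity (1 + x ^+ 2 * c ^+ 2 - 2 * x * c); first by ring.
  by rewrite -cE; ring.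
rewrite mulrA AE dE sE.
transitivity (2 * x ^+ 2 * (1 - x) * (1 - x * c) ^+ 2); first by ring.
by rewrite c2; ring.
Qed.
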